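(* Let $\Gamma$ be a finite, simple, connected, undirected, regular graph with vertex set $X$, adjacency matrix $A$, and exactly $d+1$ distinct eigenvalues. If $\mathcal{A}=\operatorname{span}\{I,A,\ldots,A^d\}$ is closed under Hadamard multiplication, then for every vertex $x$ there exists an $x$-distance-faithful intersection diagram of $\Gamma$ with $d+1$ cells. Moreover, this intersection diagram is the same around every vertex.
   Context: A partition $\pi_x=\{\mathcal{P}_0,\mathcal{P}_1,\ldots,\mathcal{P}_r\}$ of $X$ with $\mathcal{P}_0=\{x\}$ is $x$-distance-faithful if it refines the distance partition $\{\Gamma_0(x),\Gamma_1(x),\ldots,\Gamma_{\varepsilon(x)}(x)\}$ around $x$ (where $\Gamma_h(x)$ is the set of vertices at distance $h$ from $x$ and $\varepsilon(x)$ the eccentricity of $x$), i.e. all vertices in a cell are at the same distance from $x$. It is equitable if for all $i,j$ the number $c_{ij}$ of neighbours a vertex of $\mathcal{P}_i$ has in $\mathcal{P}_j$ does not depend on the chosen vertex of $\mathcal{P}_i$; its intersection diagram records the cells and the parameters $c_{ij}$. An $x$-distance-faithful intersection diagram is the intersection diagram of an equitable $x$-distance-faithful partition. ''The same around every vertex'' means: there are an integer $r$, numbers $c_{ij}$, sizes $s_i$ and distances $\delta_i$ ($0\le i,j\le r$) such that for every vertex $u$ there is an equitable $u$-distance-faithful partition $\{\mathcal{P}_0(u)=\{u\},\ldots,\mathcal{P}_r(u)\}$ with $|\mathcal{P}_i(u)|=s_i$, every vertex of $\mathcal{P}_i(u)$ at distance $\delta_i$ from $u$, and corresponding parameters $c_{ij}$.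 *)

(* Defs.v *)
From HB Require Import structures.
From mathcomp Require Import all_boot all_order all_algebra.

Set Implicit Arguments.
Unset Strict Implicit.
Unset Printing Implicit Defensive.

Import GRing.Theory Num.Theory.

(* A simple graph on the finite vertex type T is a symmetric irreflexive
   relation e : rel T. *)
Section Graphs.
Variables (T : finType) (e : rel T).

Definition neighbours (x : T) : {set T} := [set y | e x y].

Definition regular_graph : Prop :=
  exists k : nat, forall x : T, #|neighbours x| = k.

Definition connected_graph : Prop := forall x y : T, connect e x y.

Definition walk_of_length (x y : T) (h : nat) : bool :=
  [exists p : h.-tuple T, path e x p && (last x p == y)].

(* Least length of a walk from x to y; a shortest walk repeats no vertex, so
   only the lengths below #|T| need be searched.  The value is #|T| when y is
   not reachable from x. *)
Definition gdist (x y : T) : nat := find (walk_of_length x y) (iota 0 #|T|).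

Definition sphere (x : T) (h : nat) : {set T} := [set y | gdist x y == h].

Definition eccentricity (x : T) : nat := \max_(y : T) gdist x y.

Definition distance_partition (x : T) : {set {set T}} :=
  [set sphere x h | h : 'I_(eccentricity x).+1].

(* The cells P 0, ..., P r are pairwise distinct, and form a partition of T
   (in particular they are nonempty). *)
Definition indexed_partition (r : nat) (P : 'I_r.+1 -> {set T}) : Prop :=
  injective P /\ partition [set P i | i : 'I_r.+1] [set: T].

Definition distance_faithful (x : T) (r : nat) (P : 'I_r.+1 -> {set T}) : Prop :=
  [/\ indexed_partition P,
      P ord0 = [set x]
    & forall i, exists2 D, D \in distance_partition x & P i \subset D].

Definition equitable_with (r : nat) (P : 'I_r.+1 -> {set T})
    (c : 'I_r.+1 -> 'I_r.+1 -> nat) : Prop :=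
  forall i j y, y \in P i -> #|neighbours y :&: P j| = c i j.

Definition equitable (r : nat) (P : 'I_r.+1 -> {set T}) : Prop :=
  exists c, equitable_with P c.

Definition has_distance_faithful_diagram (x : T) (r : nat) : Prop :=
  exists P : 'I_r.+1 -> {set T}, distance_faithful x P /\ equitable P.

Definition same_diagram_around_every_vertex (r : nat) : Prop :=
  exists (c : 'I_r.+1 -> 'I_r.+1 -> nat) (s delta : 'I_r.+1 -> nat),
  forall u : T, exists P : 'I_r.+1 -> {set T},
    [/\ distance_faithful u P,
        equitable_with P c,
        forall i, #|P i| = s i
      & forall i y, y \in P i -> gdist u y = delta i].

End Graphs.

Local Open Scope ring_scope.

(* Rows and columns are indexed by T through its enumeration. *)
Definition adjacency_matrix (C : numClosedFieldType) (T : finType) (e : rel T)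
    : 'M[C]_#|T| :=
  \matrix_(i, j) (e (enum_val i) (enum_val j))%:R.

Definition num_distinct_eigenvalues (F : fieldType) (n : nat) (A : 'M[F]_n)
    (m : nat) : Prop :=
  exists s : seq F,
    [/\ uniq s, size s = m & forall a, (a \in s) = eigenvalue A a].

Definition power_span (F : fieldType) (n : nat) (A : 'M[F]_n) (d : nat)
    : {vspace 'M[F]_n} :=
  <<[seq A ^+ k | k <- iota 0 d.+1]>>%VS.

Definition hadamard (F : fieldType) (n : nat) (M N : 'M[F]_n) : 'M[F]_n :=
  map2_mx *%R M N.

Definition hadamard_closed (F : fieldType) (n : nat) (U : {vspace 'M[F]_n})
    : Prop :=
  forall M N, M \in U -> N \in U -> hadamard M N \in U.

(* Main.v *)
Require Import Defs.
From HB Require Import structures.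
From mathcomp Require Import all_boot all_order all_algebra.
From mathcomp Require Import ring.

(* Let [V] be the span of the powers of [A].  Since [A] is real symmetric, its
   minimal polynomial is the product of the [X - a] over the eigenvalues [a], so
   [V] has dimension [d + 1] and is closed under multiplication by [A]; by
   connectedness and regularity [V] contains the all-ones matrix [J], a multiple
   of the projection onto the valency eigenspace.  Being closed under the Hadamard
   product and containing [J], [V] is spanned by the 0/1 matrices of the classes
   of the relation "no matrix of [V] separates the pairs [(x, y)] and [(x', y')]",
   of which there are therefore [d + 1].  The cells around [x] are the rows of
   these classes.  Matrices of [V] have constant row sums, so every cell around
   every vertex is nonempty of size independent of the vertex, and the diagonal
   is a single class (apply this to the Hadamard products with [I]).  Finally the
   distance is read off the supports of the powers of [A], and the numbers of
   neighbours in a cell are the entries of the product of its class matrix with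
   [A], which lies in [V]: both depend only on the class. *)

Set Implicit Arguments.
Unset Strict Implicit.
Unset Printing Implicit Defensive.

Import GRing.Theory Num.Theory.
Local Open Scope ring_scope.

(** * Polynomials in a real symmetric matrix *)

Lemma nth_powers (F : fieldType) n (A : 'M[F]_n) d (i : 'I_d) :
  [seq A ^+ k | k <- iota 0 d]`_i = A ^+ i.
Proof. by rewrite (nth_map 0%N) ?size_iota // nth_iota. Qed.

Lemma power_spanP (F : fieldType) n (A : 'M[F]_n) d (M : 'M[F]_n) :
  M \in power_span A d <->
  exists c : nat -> F, M = \sum_(k < d.+1) c k *: A ^+ k.
Proof.
rewrite /power_span; split=> [|[c ->]].
  have sX : size [seq A ^+ k | k <- iota 0 d.+1] == d.+1.
    by rewrite size_map size_iota.
  move/(coord_span (X := Tuple sX)) => ->.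
  exists (fun i => coord (Tuple sX) (inord i) M); apply: eq_bigr => i _.
  by rewrite inord_val; congr (_ *: _); apply: nth_powers.
apply: rpred_sum => i _; apply/rpredZ/memv_span/map_f.
by rewrite mem_iota add0n ltn_ord.
Qed.

Lemma horner_mx_sum (F : fieldType) n (A : 'M[F]_n.+1) d (c : nat -> F) :
  horner_mx A (\poly_(k < d) c k) = \sum_(k < d) c k *: A ^+ k.
Proof.
rewrite poly_def rmorph_sum; apply: eq_bigr => i _ /=.
by rewrite linearZ /= rmorphXn /= horner_mx_X.
Qed.

Lemma horner_mx_power_span (F : fieldType) n (A : 'M[F]_n.+1) d (p : {poly F}) :
  (size p <= d.+1)%N -> horner_mx A p \in power_span A d.
Proof.
move=> sp; apply/power_spanP; exists (nth 0 p); rewrite -horner_mx_sum.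
congr horner_mx; apply/polyP => i; rewrite coef_poly.
by case: ltnP => // /(leq_trans sp)/(nth_default 0).
Qed.

(** A real symmetric matrix is normal, hence unitarily diagonalizable, so its minimal polynomial has
    simple roots. *)
Lemma symmetric_mxminpoly (C : numClosedFieldType) n (A : 'M[C]_n.+1) s :
  A \is symmetricmx -> A \is a realmx -> uniq s ->
  (forall a, (a \in s) = eigenvalue A a) ->
  mxminpoly A = \prod_(a <- s) ('X - a%:P).
Proof.
move=> A_sym A_real s_uniq s_eig.
have Pu := unitarymx_unit (spectral_unitarymx A).
have PA : diagonalizable_for (spectralmx A) A.
  apply/(diagonalizable_forLR Pu); exists (spectral_diag A).
  by rewrite mxpoly.conjVmx //; apply/orthomx_spectralP/symmetric_normalmx.
rewrite (diagonalizable_for_mxminpoly Pu PA); set r := undup _.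
apply/perm_big/uniq_perm => //; first exact: undup_uniq.
move=> a; rewrite s_eig eigenvalue_root_min (diagonalizable_for_mxminpoly Pu PA).
by rewrite root_prod_XsubC.
Qed.

Section SpanOfPowers.
Variables (C : numClosedFieldType) (n : nat) (A : 'M[C]_n) (d : nat).
Hypotheses (A_sym : A \is symmetricmx) (A_real : A \is a realmx).
Hypothesis A_eig : num_distinct_eigenvalues A d.+1.

Lemma num_distinct_eigenvalues_gt0 : (0 < n)%N.
Proof.
case: n A A_eig => // B [[|a s] [] // _ _ /(_ a)].
by rewrite mem_head => /esym/eigenvalueP[v _]; rewrite thinmx0 eqxx.
Qed.

(** A linear relation between the powers is a polynomial of degree at most [d] that kills the
    matrix; the minimal polynomial, of degree [d.+1], divides it. *)
Lemma dim_power_span : \dim (power_span A d) = d.+1.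
Proof.
case: n A A_sym A_real A_eig num_distinct_eigenvalues_gt0 => // m B symB realB.
move=> [s [s_uniq s_size s_eig]] _.
have pB := symmetric_mxminpoly symB realB s_uniq s_eig.
have sX : size [seq B ^+ k | k <- iota 0 d.+1] == d.+1.
  by rewrite size_map size_iota.
suff fX : free (Tuple sX) by rewrite (eqnP fX) (eqP sX).
apply/freeP => c; pose c' i := c (inord i).
rewrite (eq_bigr (fun i : 'I_d.+1 => c' i *: B ^+ i)) => [|i _]; last first.
  by rewrite /c' inord_val; congr (_ *: _); apply: nth_powers.
rewrite -horner_mx_sum => /mxminpoly_min; set p := \poly_(_ < _) _ => dvd_p.
have p0 : p = 0.
  apply/eqP; apply: contraLR dvd_p => p_neq0.
  apply/negP => /(dvdp_leq p_neq0); rewrite pB size_prod_XsubC s_size leqNgt.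
  by rewrite ltnS size_poly.
by move=> i; move/polyP/(_ i): p0; rewrite coef_poly ltn_ord coef0 /c' inord_val.
Qed.

(** Reduce ['X^h] modulo the minimal polynomial: the remainder has degree at most [d]. *)
Lemma expr_power_span h : A ^+ h \in power_span A d.
Proof.
case: n A A_sym A_real A_eig num_distinct_eigenvalues_gt0 => // m B symB realB.
move=> [s [s_uniq s_size s_eig]] _.
have pB := symmetric_mxminpoly symB realB s_uniq s_eig.
rewrite -[B in B ^+ _]horner_mx_X -rmorphXn /= (divp_eq 'X^h (mxminpoly B)).
rewrite rmorphD rmorphM /= mx_root_minpoly mulr0 add0r.
apply: horner_mx_power_span; rewrite -ltnS -s_size -(size_prod_XsubC s id) -pB.
by rewrite ltn_modp monic_neq0 ?mxminpoly_monic.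
Qed.

Lemma power_span_mulmxr M : M \in power_span A d -> M *m A \in power_span A d.
Proof.
case/power_spanP => c ->; rewrite mulmx_suml; apply: rpred_sum => k _.
by rewrite -scalemxAl -[_ *m _]/(A ^+ k * A) -exprSr rpredZ ?expr_power_span.
Qed.

Lemma power_span_sym M : M \in power_span A d -> M^T = M.
Proof.
have AT : A^T = A.
  by move/is_hermitianmxP: A_sym; rewrite expr0 scale1r map_mx_id.
case/power_spanP => c ->; rewrite linear_sum; apply: eq_bigr => k _ /=.
rewrite linearZ /=; congr (_ *: _); elim: (k : nat) => [|h IH].
  by rewrite expr0 trmx1.
by rewrite exprS trmx_mul IH AT -[_ *m _]/(A ^+ h * A) -exprSr exprS.
Qed.

(* [H] is a nonzero multiple of the projection onto the [a]-eigenspace. *)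
Lemma power_span_eigenprojection a : eigenvalue A a ->
  exists H, [/\ H \in power_span A d, H *m A = a *: H
    & exists2 c, c != 0 & forall v : 'rV_n, v *m A = a *: v -> v *m H = c *: v].
Proof.
case: n A A_sym A_real A_eig num_distinct_eigenvalues_gt0 => // m B symB realB.
move=> [s [s_uniq s_size s_eig]] _.
have pB := symmetric_mxminpoly symB realB s_uniq s_eig.
move=> a_eig; have a_s : a \in s by rewrite s_eig.
(* The minimal polynomial divided by ['X - a%:P]. On [a]-eigenvectors its value at [B] acts as the
   scalar [q.[a]], nonzero because [a] is a simple root. *)
pose q : {poly C} := \prod_(b <- rem a s) ('X - b%:P).
exists (horner_mx B q); split.
- apply: horner_mx_power_span.
  by rewrite size_prod_XsubC size_rem // s_size.
- have := mx_root_minpoly B; rewrite pB (perm_big _ (perm_to_rem a_s)) big_cons /=.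
  rewrite mulrC rmorphM rmorphB /= horner_mx_X horner_mx_C mulrBr => /eqP.
  rewrite subr_eq0 => /eqP.
  by rewrite -[_ *m _]/(_ * B) => ->; rewrite -[_ * _]/(_ *m _) mul_mx_scalar.
exists q.[a].
  by rewrite -[_ == 0]/(root q a) root_prod_XsubC mem_rem_uniqF.
move=> v vB; elim/poly_ind: q => [|p c IH].
  by rewrite rmorph0 horner0 scale0r mulmx0.
rewrite rmorphD rmorphM /= horner_mx_X horner_mx_C !hornerE mulmxDr mul_mx_scalar.
by rewrite -[_ * B]/(_ *m B) mulmxA IH -scalemxAl vB scalerA scalerDl.
Qed.

End SpanOfPowers.

(** * Classes of index pairs under a Hadamard-closed span *)

Section HadamardClasses.
Variables (F : fieldType) (n : nat) (B : seq 'M[F]_n).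

(** Names the class of a pair: two pairs have equal labels exactly when no matrix of the span of [B]
    separates them. *)
Definition label (i j : 'I_n) : seq F := [seq (M : 'M[F]_n) i j | M <- B].

Definition labels : seq (seq F) :=
  undup [seq label p.1 p.2 | p <- enum {: 'I_n * 'I_n}].

Definition class_mx (l : seq F) : 'M[F]_n := \matrix_(i, j) (label i j == l)%:R.

Lemma mem_labels i j : label i j \in labels.
Proof.
by rewrite mem_undup; apply/mapP; exists (i, j); rewrite ?mem_enum.
Qed.

Lemma labelsP l : l \in labels -> exists i j, l = label i j.
Proof. by rewrite mem_undup => /mapP[[i j] _ ->]; exists i, j. Qed.

Lemma span_label_eq M i j i' j' :
  M \in <<B>>%VS -> label i j = label i' j' -> M i j = M i' j'.
Proof.
move=> /(coord_span (X := in_tuple B)) -> eq_l; rewrite !summxE.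
apply: eq_bigr => k _; rewrite !mxE; congr (_ * _).
have := congr1 (nth 0 ^~ k) eq_l.
by rewrite !(nth_map (0 : 'M[F]_n)).
Qed.

Lemma span_label_neq i j i' j' : label i j != label i' j' ->
  exists2 M, M \in <<B>>%VS & M i j != M i' j'.
Proof.
move=> neq_l; have /hasP[M MB neqM] : has (fun M : 'M[F]_n => M i j != M i' j') B.
  apply: contraR neq_l => /hasPn eqB; apply/eqP/eq_in_map => M /eqB.
  by rewrite negbK => /eqP.
by exists M => //; apply: memv_span.
Qed.

Hypotheses (had : hadamard_closed <<B>>%VS) (J_mem : const_mx 1 \in <<B>>%VS).

Lemma class_mx_span l : l \in labels -> class_mx l \in <<B>>%VS.
Proof.
case/labelsP => i [j ->].
(* [M] is a Hadamard product of normalised matrices of the span, each separating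
   [(i, j)] from one pair carrying a different label. *)
have [M [MV Mij M0]] : exists M, [/\ M \in <<B>>%VS, M i j = 1
    & forall q, q \in enum {: 'I_n * 'I_n} -> label q.1 q.2 != label i j ->
      M q.1 q.2 = 0].
  elim: (enum _) => [|[i' j'] qs [M [MV Mij M0]]].
    by exists (const_mx 1); rewrite mxE.
  have [eq_l|neq_l] := eqVneq (label i' j') (label i j).
    exists M; split=> // q; rewrite inE => /predU1P[->|/M0 //].
    by rewrite eq_l eqxx.
  have [N NV neqN] := span_label_neq neq_l.
  pose N' := (N i j - N i' j')^-1 *: (N - N i' j' *: const_mx 1).
  have N'V : N' \in <<B>>%VS by rewrite rpredZ ?rpredB ?rpredZ.
  have nz : N i j - N i' j' != 0 by rewrite subr_eq0 eq_sym.
  exists (hadamard M N'); split; first exact: had.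
    by rewrite !mxE mulr1 mulVf // mulr1.
  move=> q; rewrite inE => /predU1P[-> _|q_qs neq_q].
    by rewrite !mxE mulr1 subrr !mulr0.
  by rewrite mxE M0 // mul0r.
suff -> : class_mx (label i j) = M by [].
apply/matrixP => i' j'; rewrite mxE.
have [eq_l|neq_l] := eqVneq; first by rewrite (span_label_eq MV eq_l) Mij.
by rewrite (M0 (i', j')) // mem_enum.
Qed.

(** The class matrices form a basis of the span: their supports are nonempty and disjoint, and every
    matrix of the span is constant on each class. *)
Lemma size_labels : size labels = \dim <<B>>%VS.
Proof.
have sX : size [seq class_mx l | l <- labels] == size labels by rewrite size_map.
have fX : free (Tuple sX).
  apply/freeP => c cE k; have [i [j l_ij]] := labelsP (mem_nth [::] (ltn_ord k)).
  move/matrixP/(_ i j): cE; rewrite summxE (bigD1 k) //= big1 => [|h h_neq_k].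
    by rewrite (nth_map [::]) // !mxE -l_ij eqxx mulr1 addr0.
  rewrite (nth_map [::]) // !mxE -l_ij nth_uniq ?undup_uniq // eq_sym.
  by rewrite val_eqE (negPf h_neq_k) mulr0.
rewrite -(eqP sX) -(eqnP fX); apply/esym; congr (\dim _); apply/eqP.
rewrite eqEsubv; apply/andP; split; last first.
  by apply/span_subvP => _ /mapP[l l_lab ->]; apply: class_mx_span.
apply/subvP => M MV.
(* The value of [M] on the class [l], read at an arbitrary pair; the default 0 is never reached for
   [l] in [labels]. *)
pose v l := if [pick p | label p.1 p.2 == l] is Some p then M p.1 p.2 else 0.
have -> : M = \sum_(l <- labels) v l *: class_mx l.
  apply/matrixP => i j; rewrite summxE (bigD1_seq (label i j)) ?undup_uniq ?mem_labels //=.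
  rewrite !mxE eqxx mulr1 big1 ?addr0 => [|l l_neq]; last first.
    by rewrite !mxE eq_sym (negPf l_neq) mulr0.
  rewrite /v; case: pickP => [p /eqP eq_l|/(_ (i, j))]; last by rewrite eqxx.
  exact/esym/span_label_eq.
by rewrite big_seq rpred_sum // => l l_lab; rewrite rpredZ // memv_span // map_f.
Qed.

End HadamardClasses.

(** * Walks and the adjacency matrix *)

Lemma walk_of_length0 (T : finType) (e : rel T) x y :
  walk_of_length e x y 0 = (x == y).
Proof.
apply/existsP/eqP => [[p]|->]; first by rewrite tuple0 /= => /eqP.
by exists [tuple]; rewrite /= eqxx.
Qed.

Lemma walk_of_lengthS (T : finType) (e : rel T) x y h :
  walk_of_length e x y h.+1 = [exists z, e x z && walk_of_length e z y h].
Proof.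
apply/existsP/existsP => [[p]|[z /andP[xz /existsP[p zy]]]].
  case/tupleP: p => z p /=; rewrite -andbA => /andP[xz zy].
  by exists z; rewrite xz; apply/existsP; exists p.
by exists [tuple of z :: p]; rewrite /= xz.
Qed.

Section AdjacencyMatrix.
Variables (C : numClosedFieldType) (T : finType) (e : rel T).
Hypothesis e_sym : symmetric e.
Let A := adjacency_matrix C e.

Lemma adjacency_matrixE x y : A (enum_rank x) (enum_rank y) = (e x y)%:R.
Proof. by rewrite mxE !enum_rankK. Qed.

Lemma adjacency_matrix_sym : A \is symmetricmx.
Proof.
apply/is_hermitianmxP; rewrite expr0 scale1r map_mx_id //.
by apply/matrixP => i j; rewrite !mxE e_sym.
Qed.

Lemma adjacency_matrix_real : A \is a realmx.
Proof. by apply/mxOverP => i j; rewrite mxE realn. Qed.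

Lemma sum_enum_rank (F : 'I_#|T| -> C) : \sum_i F i = \sum_x F (enum_rank x).
Proof. by rewrite (reindex _ (onW_bij _ (@enum_rank_bij T))). Qed.

(** Nonnegativity is carried through the induction because it rules out cancellation: the sum over
    the first step is nonzero iff some term is. *)
Lemma walk_of_length_expr h x y :
  0 <= (A ^+ h) (enum_rank x) (enum_rank y) /\
  walk_of_length e x y h = ((A ^+ h) (enum_rank x) (enum_rank y) != 0).
Proof.
elim: h x => [|h IH] x.
  rewrite expr0 walk_of_length0 mxE (inj_eq enum_rank_inj) ler0n pnatr_eq0.
  by case: eqP.
rewrite exprS mxE sum_enum_rank walk_of_lengthS.
have ge0 z : true ->
    0 <= A (enum_rank x) (enum_rank z) * (A ^+ h) (enum_rank z) (enum_rank y).
  by move=> _; rewrite adjacency_matrixE mulr_ge0 ?ler0n //; case: (IH z).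
split; first exact: sumr_ge0.
rewrite psumr_eq0 // -has_predC; apply/existsP/hasP => [[z]|[z _]].
  rewrite (IH z).2 => /andP[xz nz]; exists z; first exact: mem_index_enum.
  by rewrite /= adjacency_matrixE xz mul1r.
rewrite /= adjacency_matrixE; case xz: (e x z); last by rewrite mul0r eqxx.
by rewrite mul1r => nz; exists z; rewrite xz (IH z).2.
Qed.

Variable k : nat.
Hypothesis e_reg : forall x, #|neighbours e x| = k.

Lemma sum_adjacent x : \sum_y (e x y)%:R = k%:R :> C.
Proof.
rewrite -natr_sum -(e_reg x) -sum1_card [in RHS]big_mkcond.
by congr _%:R; apply: eq_bigr => y _; rewrite inE; case: (e x y).
Qed.

(* The Dirichlet form [\sum_(x ~ y) `|f x - f y| ^ 2 = 2 <f, (k - A) f>]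
   vanishes at [f]. *)
Lemma eigenfunction_const (f : T -> C) : connected_graph e ->
  (forall x, \sum_y (e x y)%:R * f y = k%:R * f x) -> forall x y, f x = f y.
Proof.
move=> e_conn f_eig.
have f_adj x y : e x y -> f x = f y.
  (* Expanding the square in the Dirichlet form gives four double sums, each equal to [N] up to
     sign: the diagonal ones by regularity, the mixed ones by [f_eig], after exchanging [x] and [y]
     where needed. *)
  pose N := \sum_x k%:R * (f x * (f x)^*).
  have sum1 : \sum_x \sum_y (e x y)%:R * (f x * (f x)^*) = N.
    by apply: eq_bigr => z _; rewrite -mulr_suml sum_adjacent.
  have sum2 : \sum_x \sum_y (e x y)%:R * (f y * (f x)^*) = N.
    apply: eq_bigr => z _; under eq_bigr do rewrite mulrA.
    by rewrite -mulr_suml f_eig mulrA.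
  have swap g : \sum_x \sum_y (e x y)%:R * g x y = \sum_x \sum_y (e x y)%:R * g y x :> C.
    rewrite exchange_big; apply: eq_bigr => z _; apply: eq_bigr => w _.
    by rewrite e_sym.
  have : \sum_x \sum_y (e x y)%:R * `|f x - f y| ^+ 2 = 0.
    rewrite (eq_bigr (fun x => \sum_y (e x y)%:R * (f x * (f x)^*)
       - \sum_y (e x y)%:R * (f y * (f x)^*)
       - (\sum_y (e x y)%:R * (f x * (f y)^*)
       - \sum_y (e x y)%:R * (f y * (f y)^*)))) => [|z _].
      by rewrite !sumrB sum1 sum2 swap sum2 (swap (fun x y => f y * (f y)^*)) sum1 !subrr.
    rewrite -!sumrB; apply: eq_bigr => w _.
    by rewrite normCK rmorphB /=; ring.
  have ge0 z w : 0 <= (e z w)%:R * `|f z - f w| ^+ 2.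
    by rewrite mulr_ge0 ?ler0n ?exprn_ge0.
  move/eqP; rewrite psumr_eq0 => [|z _]; last by apply: sumr_ge0.
  move/allP/(_ x (mem_index_enum _)); rewrite psumr_eq0 //.
  move/allP/(_ y (mem_index_enum _)) => /= + xy.
  by rewrite xy mul1r sqrf_eq0 normr_eq0 subr_eq0 => /eqP.
move=> x y; have /connectP[p + ->] := e_conn x y.
by elim: p x => //= z p IH x /andP[/f_adj -> /IH].
Qed.

Lemma const_mul_adjacency : const_mx 1 *m A = k%:R *: const_mx 1 :> 'rV_#|T|.
Proof.
apply/rowP => j; rewrite !mxE mulr1 -(sum_adjacent (enum_val j)) sum_enum_rank.
by apply: eq_bigr => x _; rewrite !mxE enum_rankK mul1r e_sym.
Qed.

(** By regularity the all-ones column is an eigenvector of [A], hence of every polynomial in [A]. *)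
Lemma power_span_row_sum d M : M \in power_span A d ->
  exists c, forall i, \sum_j M i j = c.
Proof.
have A1 : A *m const_mx 1 = k%:R *: const_mx 1 :> 'cV_#|T|.
  apply: trmx_inj; rewrite trmx_mul linearZ /= !trmx_const.
  rewrite -const_mul_adjacency; congr (_ *m _).
  by apply/matrixP => i j; rewrite !mxE e_sym.
case/power_spanP => a ->; exists (\sum_(h < d.+1) a h * k%:R ^+ h) => i.
have expA h : A ^+ h *m const_mx 1 = k%:R ^+ h *: const_mx 1 :> 'cV_#|T|.
  elim: h => [|h IH]; first by rewrite !expr0 mul1mx scale1r.
  by rewrite exprSr -mulmxA A1 -scalemxAr IH scalerA -exprS.
under eq_bigr do rewrite summxE.
rewrite exchange_big; apply: eq_bigr => h _ /=.
have /colP/(_ i) := expA h; rewrite !mxE mulr1 => <-.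
by rewrite mulr_sumr; apply: eq_bigr => j _; rewrite !mxE mulr1.
Qed.

Lemma ones_power_span d : connected_graph e -> num_distinct_eigenvalues A d.+1 ->
  const_mx 1 \in power_span A d.
Proof.
move=> e_conn A_eig.
have symA := adjacency_matrix_sym; have realA := adjacency_matrix_real.
have n_gt0 := num_distinct_eigenvalues_gt0 A_eig.
pose i0 := Ordinal n_gt0.
have v_neq0 : const_mx 1 != 0 :> 'rV[C]_#|T|.
  by apply/eqP => /rowP/(_ i0)/eqP; rewrite !mxE oner_eq0.
have eig_k : eigenvalue A k%:R.
  by apply/eigenvalueP; exists (const_mx 1); rewrite ?const_mul_adjacency.
have [H [HV HA [c c_neq0 cH]]] := power_span_eigenprojection symA realA A_eig eig_k.
(* Each row of [H] is an eigenvector for the valency, hence constant; by symmetry [H] is then a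
   multiple of the all-ones matrix. *)
have Hrow i j j' : H i j = H i j'.
  rewrite -[j]enum_valK -[j']enum_valK.
  apply: (eigenfunction_const (f := fun x => H i (enum_rank x))) => // x.
  move/matrixP/(_ i (enum_rank x)): HA; rewrite !mxE => <-.
  rewrite sum_enum_rank; apply: eq_bigr => y _.
  by rewrite adjacency_matrixE e_sym mulrC.
have HT := power_span_sym symA HV.
have Hconst i j : H i j = H i0 i0.
  by rewrite (Hrow i j i0) -{1}HT mxE; apply: Hrow.
(* Otherwise [H] would vanish, yet it multiplies the all-ones row by [c], which is nonzero. *)
have H0 : H i0 i0 != 0.
  apply: contraNneq c_neq0 => H0; have := cH _ const_mul_adjacency.
  move/rowP/(_ i0); rewrite !mxE mulr1 => <-.
  by rewrite big1 // => j _; rewrite Hconst H0 mulr0.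
suff -> : const_mx 1 = (H i0 i0)^-1 *: H by rewrite rpredZ.
by apply/matrixP => i j; rewrite !mxE Hconst mulVf.
Qed.

End AdjacencyMatrix.

(** * The cells around a vertex and their parameters *)

Section DistanceFaithfulCells.
Variables (C : numClosedFieldType) (T : finType) (e : rel T) (d : nat).
Hypotheses (e_sym : symmetric e) (e_conn : connected_graph e).
Variable k : nat.
Hypothesis e_reg : forall x, #|neighbours e x| = k.
Let A := adjacency_matrix C e.
Let V := power_span A d.
Hypotheses (A_eig : num_distinct_eigenvalues A d.+1) (had : hadamard_closed V).

Let symA := adjacency_matrix_sym C e_sym.
Let realA := adjacency_matrix_real C e.
Let J_mem : const_mx 1 \in V := ones_power_span e_sym e_reg e_conn A_eig.

Definition pair_label (x y : T) : seq C :=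
  label [seq A ^+ h | h <- iota 0 d.+1] (enum_rank x) (enum_rank y).

Local Notation classes := (labels [seq A ^+ h | h <- iota 0 d.+1]).

Definition cell (l : seq C) (x : T) : {set T} := [set y | pair_label x y == l].

Lemma power_span_pair_label M x y x' y' :
  M \in V -> pair_label x y = pair_label x' y' ->
  M (enum_rank x) (enum_rank y) = M (enum_rank x') (enum_rank y').
Proof. exact: span_label_eq. Qed.

(** The row sums of [hadamard M 1], which lies in [V], are the diagonal entries of [M]. *)
Lemma power_span_diag M x y :
  M \in V -> M (enum_rank x) (enum_rank x) = M (enum_rank y) (enum_rank y).
Proof.
move=> MV; have M1 : hadamard M 1 \in V.
  by apply: had => //; apply: (expr_power_span symA realA A_eig 0).
have [c row_c] := power_span_row_sum e_sym e_reg M1.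
have diag_c i : M i i = c.
  rewrite -(row_c i) (bigD1 i) //= big1 => [|j ji].
    by rewrite addr0 !mxE eqxx mulr1.
  by rewrite !mxE eq_sym (negPf ji) mulr0.
by rewrite !diag_c.
Qed.

Lemma pair_label_diag x y : pair_label x x = pair_label y y.
Proof.
apply/eq_in_map => M MB; apply: power_span_diag.
exact: memv_span.
Qed.

Lemma cell_diag x y : cell (pair_label x x) y = [set y].
Proof.
apply/setP => z; rewrite !inE; apply/eqP/eqP => [eq_l|->]; last exact: pair_label_diag.
(* The identity [A ^+ 0] separates diagonal from off-diagonal pairs. *)
have := power_span_pair_label (expr_power_span symA realA A_eig 0) eq_l.
rewrite !mxE eqxx (inj_eq enum_rank_inj); case: eqP => // _ /eqP.
by rewrite eq_sym oner_eq0.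
Qed.

(** These sizes are row sums of the class matrix of [l]. *)
Lemma card_cell l x y : l \in classes -> #|cell l x| = #|cell l y|.
Proof.
move=> /(class_mx_span had J_mem)/(power_span_row_sum e_sym e_reg)[c row_c].
suff cellE z : #|cell l z|%:R = c :> C by apply/eqP; rewrite -(eqr_nat C) !cellE.
rewrite -(row_c (enum_rank z)) sum_enum_rank -sum1_card natr_sum big_mkcond.
by apply: eq_bigr => w _; rewrite mxE inE; case: eqP.
Qed.

(** The label occurs at some pair, so its cell is nonempty around one vertex, hence around all by
    [card_cell]. *)
Lemma cell_neq0 l x : l \in classes -> exists y, y \in cell l x.
Proof.
move=> l_lab; have [i [j l_ij]] := labelsP l_lab.
apply/set0Pn; rewrite -card_gt0 (card_cell x (enum_val i) l_lab) card_gt0.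
by apply/set0Pn; exists (enum_val j); rewrite inE /pair_label !enum_valK -l_ij.
Qed.

Lemma gdist_pair_label x y x' y' :
  pair_label x y = pair_label x' y' -> gdist e x y = gdist e x' y'.
Proof.
move=> eq_l; apply: eq_find => h; rewrite !(walk_of_length_expr C e h _ _).2.
by rewrite (power_span_pair_label (expr_power_span symA realA A_eig h) eq_l).
Qed.

Lemma card_neighbours_cell l x y x' y' :
  l \in classes -> pair_label x y = pair_label x' y' ->
  #|neighbours e y :&: cell l x| = #|neighbours e y' :&: cell l x'|.
Proof.
move=> /(class_mx_span had J_mem)/(power_span_mulmxr symA realA A_eig) lA eq_l.
have := power_span_pair_label lA eq_l.
(* Row [z] of the class matrix is the indicator of [cell l z], and column [w] of [A] that of the
   neighbours of [w]. *)
have cardE z w : (class_mx [seq A ^+ h | h <- iota 0 d.+1] l *m A)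
    (enum_rank z) (enum_rank w) = #|neighbours e w :&: cell l z|%:R.
  rewrite mxE sum_enum_rank -sum1_card natr_sum [RHS]big_mkcond.
  apply: eq_bigr => v _; rewrite adjacency_matrixE mxE !inE e_sym.
  by case: (e w v); rewrite ?mulr0 // mulr1; case: eqP.
by rewrite !cardE => /eqP; rewrite eqr_nat => /eqP.
Qed.

Lemma same_diagram : same_diagram_around_every_vertex e d.
Proof.
pose x0 : T := enum_val (Ordinal (num_distinct_eigenvalues_gt0 A_eig)).
have l0_lab : pair_label x0 x0 \in classes by apply: mem_labels.
(* The diagonal label is moved to index 0, so that the first cell around [u] is the singleton of
   [u]. *)
pose L := pair_label x0 x0 :: rem (pair_label x0 x0) classes.
have permL : perm_eq classes L by apply: perm_to_rem.
have uniqL : uniq L by rewrite -(perm_uniq permL) undup_uniq.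
have sizeL : size L = d.+1.
  rewrite -(perm_size permL) (size_labels had J_mem).
  exact: (dim_power_span symA realA A_eig).
pose l (i : 'I_d.+1) := nth [::] L i.
have l_lab i : l i \in classes by rewrite (perm_mem permL) mem_nth ?sizeL.
have l_inj : injective l.
  by move=> i j /eqP; rewrite nth_uniq ?sizeL // => /eqP/val_inj.
pose rep i := odflt x0 [pick y in cell (l i) x0].
have repP i : pair_label x0 (rep i) = l i.
  rewrite /rep; case: pickP => [y|no_y]; first by rewrite inE => /eqP.
  by have [y] := cell_neq0 x0 (l_lab i); rewrite no_y.
exists (fun i j => #|neighbours e (rep i) :&: cell (l j) x0|).
exists (fun i => #|cell (l i) x0|), (fun i => gdist e x0 (rep i)) => u.
have cellP i y : y \in cell (l i) u -> pair_label u y = pair_label x0 (rep i).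
  by rewrite inE => /eqP ->; rewrite repP.
exists (fun i => cell (l i) u); split=> [|i j y /cellP|i|i y /cellP].
- split; last first.
  + move=> i; exists (sphere e u (gdist e x0 (rep i))); last first.
      by apply/subsetP => y /cellP eq_l; rewrite inE (gdist_pair_label eq_l).
    (* A vertex of the cell around [u] realizes this distance, which is therefore at most the
       eccentricity of [u]. *)
    have [y /cellP/gdist_pair_label <-] := cell_neq0 u (l_lab i).
    apply/imsetP; have lt_ecc : (gdist e u y < (eccentricity e u).+1)%N.
      by rewrite ltnS; apply: (leq_bigmax y).
    by exists (Ordinal lt_ecc).
  + exact: cell_diag.
  split=> [i j /= eq_ij|].
    have [y yi] := cell_neq0 u (l_lab i); have yj := yi; rewrite eq_ij in yj.
    by move: yi yj; rewrite !inE => /eqP li /eqP lj; apply: l_inj; rewrite -li.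
  apply/and3P; split.
  + rewrite eqEsubset subsetT; apply/subsetP => y _.
    have y_lab : pair_label u y \in L by rewrite -(perm_mem permL) mem_labels.
    have lt_d : (index (pair_label u y) L < d.+1)%N by rewrite -sizeL index_mem.
    apply/bigcupP; exists (cell (l (Ordinal lt_d)) u); first exact: imset_f.
    by rewrite inE /l nth_index.
  + apply/trivIsetP => _ _ /imsetP[i _ ->] /imsetP[j _ ->] neq_ij.
    rewrite -setI_eq0; apply: contraNT neq_ij => /set0Pn[y].
    by rewrite !inE => /andP[/eqP <- /eqP <-].
  + apply/imsetP => -[i _ /setP eq0].
    by have [y] := cell_neq0 u (l_lab i); rewrite -eq0 inE.
- exact: card_neighbours_cell.
- exact: card_cell.
- exact: gdist_pair_label.
Qed.

End DistanceFaithfulCells.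

Theorem theorem1p3 (C : numClosedFieldType) (T : finType) (e : rel T) (d : nat)
    (e_sym : symmetric e) (e_irr : irreflexive e)
    (e_conn : connected_graph e) (e_reg : regular_graph e)
    (e_eig : num_distinct_eigenvalues (adjacency_matrix C e) d.+1)
    (e_had : hadamard_closed (power_span (adjacency_matrix C e) d)) :
  (forall x : T, has_distance_faithful_diagram e x d) /\
  same_diagram_around_every_vertex e d.
Proof.
have [k e_k] := e_reg; have same := same_diagram e_sym e_conn e_k e_eig e_had.
split=> // x; have [c [s [delta /(_ x)[P [P_df P_eq _ _]]]]] := same.
by exists P; split=> //; exists c.
Qed.
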